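(* There is no set $T$ of first-order sentences in the language of categories with a designated subcategory such that for every finitely bicomplete category $\mathcal{C}$ and every subcategory $\mathcal{W}$ of $\mathcal{C}$ the following equivalence holds: the structure $(\mathcal{C},\mathcal{W})$ satisfies every sentence of $T$ if and only if $(\mathcal{C},\mathcal{W})$ extends to a model structure, i.e. there exists a model structure on $\mathcal{C}$ whose class of weak equivalences is $\mathcal{W}$.
   Context: The language of categories with a designated subcategory is the first-order language whose variables range over the objects and morphisms of a category (quantification over elements only, not over sets or functions), with symbols for source, target, identities and composition, together with predicates singling out the objects and morphisms of the designated subcategory $\mathcal{W}$ (the weak equivalences). A category is finitely bicomplete if it has all finite limits and finite colimits. Lifting: for morphisms $f:A\to B$ and $g:X\to Y$, $f$ lifts on the left of $g$ if every commutative square from $f$ to $g$ (with top $A\to X$ and bottom $B\to Y$) admits a morphism $h:B\to X$ making the diagram commute. For a class $S$ of morphisms, $\mathrm{RLP}(S)$ is the class of morphisms $g$ such that every $f\in S$ lifts on the left of $g$, and $\mathrm{LLP}(S)$ is the class of morphisms $f$ that lift on the left of every $g\in S$. A weak factorization system (WFS) is a pair $(\mathcal{L},\mathcal{R})$ of classes of morphisms with $\mathcal{L}=\mathrm{LLP}(\mathcal{R})$, $\mathcal{R}=\mathrm{RLP}(\mathcal{L})$, such that every morphism factors as a morphism in $\mathcal{L}$ followed by a morphism in $\mathcal{R}$. A model structure on a finitely bicomplete category $\mathcal{C}$ consists of three subcategories $\mathbb{C}_{we}$ (weak equivalences), $\mathbb{C}_{cof}$ (cofibrations), $\mathbb{C}_{fib}$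 (fibrations) such that $(\mathbb{C}_{cof},\mathbb{C}_{fib}\cap\mathbb{C}_{we})$ and $(\mathbb{C}_{cof}\cap\mathbb{C}_{we},\mathbb{C}_{fib})$ are WFSs, and such that whenever two of $f$, $g$, $gf$ are in $\mathbb{C}_{we}$, so is the third. *)

(* Defs.v *)
From Stdlib Require Import FinFun.

Set Implicit Arguments.
Unset Strict Implicit.
Unset Printing Implicit Defensive.

(** Objects and morphisms may form types of any size in the ambient universes,
    and equality of objects and of morphisms is Leibniz equality. *)
Record category := Category {
  Ob : Type;
  Hom : Ob -> Ob -> Type;
  idm : forall x, Hom x x;
  comp : forall x y z, Hom y z -> Hom x y -> Hom x z;
  comp_assoc : forall w x y z (h : Hom y z) (g : Hom x y) (f : Hom w x),
    comp h (comp g f) = comp (comp h g) f;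
  comp_idl : forall x y (f : Hom x y), comp (idm y) f = f;
  comp_idr : forall x y (f : Hom x y), comp f (idm x) = f
}.

Arguments Hom {c} _ _.
Arguments idm {c} x.
Arguments comp {c x y z} g f.

Declare Scope cat_scope.
Local Open Scope cat_scope.
Notation "g \o f" := (comp g f) (at level 50, left associativity) : cat_scope.

Record subcategory (C : category) := Subcategory {
  sub_ob : Ob C -> Prop;
  sub_mor : forall x y : Ob C, Hom x y -> Prop;
  sub_src : forall (x y : Ob C) (f : Hom x y), sub_mor f -> sub_ob x;
  sub_tgt : forall (x y : Ob C) (f : Hom x y), sub_mor f -> sub_ob y;
  sub_idm : forall x : Ob C, sub_ob x -> sub_mor (idm x);
  sub_comp : forall (x y z : Ob C) (g : Hom y z) (f : Hom x y),
    sub_mor g -> sub_mor f -> sub_mor (g \o f)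
}.

Arguments sub_ob {C} s x.
Arguments sub_mor {C} s {x y} f.

Record functor (J C : category) := Functor {
  fob : Ob J -> Ob C;
  fmor : forall i j : Ob J, Hom i j -> Hom (fob i) (fob j);
  fmor_idm : forall i : Ob J, fmor (idm i) = idm (fob i);
  fmor_comp : forall (i j k : Ob J) (v : Hom j k) (u : Hom i j),
    fmor (v \o u) = fmor v \o fmor u
}.

Arguments fob {J C} f i.
Arguments fmor {J C} f {i j} u.

Definition finite_category (J : category) : Prop :=
  Finite (Ob J) /\ forall i j : Ob J, Finite (Hom i j).

Definition is_cone (J C : category) (D : functor J C) (x : Ob C)
    (p : forall i, Hom x (fob D i)) : Prop :=
  forall (i j : Ob J) (u : Hom i j), fmor D u \o p i = p j.

Definition is_cocone (J C : category) (D : functor J C) (x : Ob C)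
    (q : forall i, Hom (fob D i) x) : Prop :=
  forall (i j : Ob J) (u : Hom i j), q j \o fmor D u = q i.

Definition is_limit (J C : category) (D : functor J C) (x : Ob C)
    (p : forall i, Hom x (fob D i)) : Prop :=
  is_cone p /\
  forall (y : Ob C) (r : forall i, Hom y (fob D i)), is_cone r ->
    exists! h : Hom y x, forall i, p i \o h = r i.

Definition is_colimit (J C : category) (D : functor J C) (x : Ob C)
    (q : forall i, Hom (fob D i) x) : Prop :=
  is_cocone q /\
  forall (y : Ob C) (r : forall i, Hom (fob D i) y), is_cocone r ->
    exists! h : Hom x y, forall i, h \o q i = r i.

Definition finitely_bicomplete (C : category) : Prop :=
  forall J : category, finite_category J -> forall D : functor J C,
    (exists (x : Ob C) (p : forall i, Hom x (fob D i)), is_limit p) /\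
    (exists (x : Ob C) (q : forall i, Hom (fob D i) x), is_colimit q).

Definition mor_class (C : category) := forall x y : Ob C, Hom x y -> Prop.

Definition lifts (C : category) (a b x y : Ob C) (f : Hom a b) (g : Hom x y) :
    Prop :=
  forall (u : Hom a x) (v : Hom b y), g \o u = v \o f ->
    exists h : Hom b x, h \o f = u /\ g \o h = v.

Definition LLP (C : category) (S : mor_class C) : mor_class C :=
  fun a b f => forall (x y : Ob C) (g : Hom x y), S x y g -> lifts f g.

Definition RLP (C : category) (S : mor_class C) : mor_class C :=
  fun x y g => forall (a b : Ob C) (f : Hom a b), S a b f -> lifts f g.

Record is_wfs (C : category) (L R : mor_class C) : Prop := IsWfs {
  wfs_left : forall (x y : Ob C) (f : Hom x y), L x y f <-> LLP R f;
  wfs_right : forall (x y : Ob C) (f : Hom x y), R x y f <-> RLP L f;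
  wfs_fact : forall (x y : Ob C) (f : Hom x y),
    exists (z : Ob C) (l : Hom x z) (r : Hom z y),
      L x z l /\ R z y r /\ f = r \o l
}.

Definition class_of (C : category) (S : subcategory C) : mor_class C :=
  fun x y f => sub_mor S f.

Definition class_cap (C : category) (S S' : subcategory C) : mor_class C :=
  fun x y f => sub_mor S f /\ sub_mor S' f.

(** Closure of weak equivalences under composition, the remaining case of
    two-out-of-three, is part of [we] being a subcategory. *)
Record model_structure (C : category) := ModelStructure {
  we : subcategory C;
  cof : subcategory C;
  fib : subcategory C;
  wfs_cof_tfib : is_wfs (class_of cof) (class_cap fib we);
  wfs_tcof_fib : is_wfs (class_cap cof we) (class_of fib);
  we_cancel_left : forall (x y z : Ob C) (g : Hom y z) (f : Hom x y),
    sub_mor we g -> sub_mor we (g \o f) -> sub_mor we f;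
  we_cancel_right : forall (x y z : Ob C) (g : Hom y z) (f : Hom x y),
    sub_mor we f -> sub_mor we (g \o f) -> sub_mor we g
}.

Definition extends_to_model_structure (C : category) (W : subcategory C) :
    Prop :=
  exists M : model_structure C, we M = W.

(** Two sorts, objects and morphisms.  [V] and [M] are the types of object
    variables and morphism variables in scope; a quantifier over a sort adds the
    variable [None] to the corresponding type, so sentences are the formulas
    over empty types of variables. *)

Inductive ob_term (V M : Set) : Set :=
  | OVar (v : V)
  | Src (t : mor_term V M)
  | Tgt (t : mor_term V M)
with mor_term (V M : Set) : Set :=
  | MVar (m : M)
  | Idm (t : ob_term V M).

(** Composition is partial, so it enters as its graph: [CompIs g f h] means
    that [g] and [f] are composable with composite [h]. *)
Inductive formula (V M : Set) : Set :=
  | EqOb (s t : ob_term V M)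
  | EqMor (s t : mor_term V M)
  | CompIs (g f h : mor_term V M)
  | InWOb (t : ob_term V M)
  | InWMor (t : mor_term V M)
  | FFalse
  | FImp (p q : formula V M)
  | FAnd (p q : formula V M)
  | FOr (p q : formula V M)
  | AllOb (p : formula (option V) M)
  | ExOb (p : formula (option V) M)
  | AllMor (p : formula V (option M))
  | ExMor (p : formula V (option M)).

Arguments OVar {V M} v.
Arguments MVar {V M} m.
Arguments FFalse {V M}.

Definition sentence : Set := formula Empty_set Empty_set.

Record arrow (C : category) := Arrow {
  arr_src : Ob C;
  arr_tgt : Ob C;
  arr : Hom arr_src arr_tgt
}.

Arguments Arrow {C arr_src arr_tgt} arr.

Inductive composite (C : category) : arrow C -> arrow C -> arrow C -> Prop :=
  Composite : forall (x y z : Ob C) (g : Hom y z) (f : Hom x y),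
    composite (Arrow g) (Arrow f) (Arrow (g \o f)).

Definition ext (V : Set) (A : Type) (e : V -> A) (a : A) : option V -> A :=
  fun o => match o with Some v => e v | None => a end.

Fixpoint eval_ob (C : category) (V M : Set) (eo : V -> Ob C)
    (em : M -> arrow C) (t : ob_term V M) : Ob C :=
  match t with
  | OVar v => eo v
  | Src s => arr_src (eval_mor eo em s)
  | Tgt s => arr_tgt (eval_mor eo em s)
  end
with eval_mor (C : category) (V M : Set) (eo : V -> Ob C)
    (em : M -> arrow C) (t : mor_term V M) : arrow C :=
  match t with
  | MVar m => em m
  | Idm s => Arrow (idm (eval_ob eo em s))
  end.

Fixpoint sat (C : category) (W : subcategory C) (V M : Set)
    (p : formula V M) (eo : V -> Ob C) (em : M -> arrow C) : Prop :=
  match p with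
  | EqOb s t => eval_ob eo em s = eval_ob eo em t
  | EqMor s t => eval_mor eo em s = eval_mor eo em t
  | CompIs g f h =>
      composite (eval_mor eo em g) (eval_mor eo em f) (eval_mor eo em h)
  | InWOb t => sub_ob W (eval_ob eo em t)
  | InWMor t => sub_mor W (arr (eval_mor eo em t))
  | FFalse => False
  | FImp p q => sat W p eo em -> sat W q eo em
  | FAnd p q => sat W p eo em /\ sat W q eo em
  | FOr p q => sat W p eo em \/ sat W q eo em
  | AllOb p => forall a : Ob C, sat W p (ext eo a) em
  | ExOb p => exists a : Ob C, sat W p (ext eo a) em
  | AllMor p => forall f : arrow C, sat W p eo (ext em f)
  | ExMor p => exists f : arrow C, sat W p eo (ext em f)
  end.

Definition satisfies (C : category) (W : subcategory C) (p : sentence) : Prop :=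
  sat W p (fun v : Empty_set => match v with end)
          (fun m : Empty_set => match m with end).

(* Main.v *)
(** Let [nat * J] carry the lattice of the subsets that are constant across all but finitely many rows and across all but finitely many columns, and let the weak equivalences be the inclusions adding finitely many points.  Finite partial bijections between two infinite sets [J] and [K] induce a back-and-forth system between these structures, so their first-order theories do not depend on [J].

    For [J = nat] a model structure exists: every class of sets up to finite difference has a representative depending monotonically on the class, because the rows can be cut down to the part above the diagonal and the columns to the part below it, which makes them disjoint; these representatives are the bifibrant objects.

    In any model structure, cofibrant replacements [A i] of the rows and fibrant replacements [B j] of the complements of the columns satisfy [A i <= B j].  This gives finite sets [f i] and [g j] such that [j] is in [f i] or [i] is in [g j] for all [i] and [j].  That is impossible for [J = nat -> bool]: some [j] is in no [f i], and then [g j] contains all of [nat]. *)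
Require Import Defs.
From Stdlib Require Import List Arith Lia Cantor FinFun Classical
  IndefiniteDescription FunctionalExtensionality PropExtensionality.

Set Implicit Arguments.
Unset Strict Implicit.
Unset Printing Implicit Defensive.

(** * Bounded lattices as finitely bicomplete thin categories *)

Record blattice := Blattice {
  carrier :> Type;
  le : carrier -> carrier -> Prop;
  meet : carrier -> carrier -> carrier;
  join : carrier -> carrier -> carrier;
  bot : carrier;
  top : carrier;
  le_refl : forall x, le x x;
  le_trans : forall x y z, le x y -> le y z -> le x z;
  le_antisym : forall x y, le x y -> le y x -> x = y;
  meet_lbl : forall x y, le (meet x y) x;
  meet_lbr : forall x y, le (meet x y) y;
  meet_glb : forall x y z, le z x -> le z y -> le z (meet x y);
  join_ubl : forall x y, le x (join x y);
  join_ubr : forall x y, le y (join x y);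
  join_lub : forall x y z, le x z -> le y z -> le (join x y) z;
  bot_le : forall x, le bot x;
  le_top : forall x, le x top
}.

Arguments le {b} x y.
Arguments meet {b} x y.
Arguments join {b} x y.
Arguments bot {b}.
Arguments top {b}.
Arguments le_refl {b} x.

Definition lat_cat (P : blattice) : category.
Proof.
refine (@Category P (@le P) le_refl
          (fun x y z g f => le_trans f g) _ _ _);
  intros; apply proof_irrelevance.
Defined.

Lemma lat_hom_eq (P : blattice) (x y : Ob (lat_cat P)) (f g : Hom x y) : f = g.
Proof. exact (proof_irrelevance (@le P x y) f g). Qed.

Lemma fold_meet_le (P : blattice) (A : Type) (F : A -> P) (l : list A) a :
  In a l -> le (fold_right (fun i m => meet (F i) m) top l) (F a).
Proof.
induction l as [|b l IH]; simpl; [easy|intros [<-|H]].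
- apply meet_lbl.
- exact (le_trans (meet_lbr _ _) (IH H)).
Qed.

Lemma le_fold_meet (P : blattice) (A : Type) (F : A -> P) (l : list A) y :
  (forall a, le y (F a)) -> le y (fold_right (fun i m => meet (F i) m) top l).
Proof.
intros H; induction l as [|b l IH]; simpl; [apply le_top|].
now apply meet_glb.
Qed.

Lemma le_fold_join (P : blattice) (A : Type) (F : A -> P) (l : list A) a :
  In a l -> le (F a) (fold_right (fun i m => join (F i) m) bot l).
Proof.
induction l as [|b l IH]; simpl; [easy|intros [<-|H]].
- apply join_ubl.
- exact (le_trans (IH H) (join_ubr _ _)).
Qed.

Lemma fold_join_le (P : blattice) (A : Type) (F : A -> P) (l : list A) y :
  (forall a, le (F a) y) -> le (fold_right (fun i m => join (F i) m) bot l) y.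
Proof.
intros H; induction l as [|b l IH]; simpl; [apply bot_le|].
now apply join_lub.
Qed.

(** Every family of morphisms over a diagram in a thin category is a cone, so limits and colimits
    are the meets and joins of the listed objects. *)
Lemma lat_cat_finitely_bicomplete (P : blattice) :
  finitely_bicomplete (lat_cat P).
Proof.
intros J [[l Hl] _] D; split.
- exists (fold_right (fun i m => meet (b := P) (fob D i) m) top l).
  exists (fun i => fold_meet_le (fun i => fob D i : P) (Hl i)); split.
  + intros i j u; apply lat_hom_eq.
  + intros y r _; exists (le_fold_meet (P := P) l r); split;
      intros; apply lat_hom_eq.
- exists (fold_right (fun i m => join (b := P) (fob D i) m) bot l).
  exists (fun i => le_fold_join (fun i => fob D i : P) (Hl i)); split.
  + intros i j u; apply lat_hom_eq.
  + intros y r _; exists (fold_join_le (P := P) l r); split;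
      intros; apply lat_hom_eq.
Qed.

(** [w] relates arbitrary pairs, so it may be symmetric; only its comparable pairs become
    morphisms. *)
Definition wide_sub (P : blattice) (w : P -> P -> Prop)
    (wr : forall x, w x x) (wt : forall x y z, w x y -> w y z -> w x z) :
  subcategory (lat_cat P) :=
  @Subcategory (lat_cat P) (fun _ => True) (fun x y _ => w x y)
    (fun _ _ _ _ => I) (fun _ _ _ _ => I) (fun x _ => wr x)
    (fun x y z _ _ G F => wt x y z F G).

(** * Lifting properties and weak factorization systems in a lattice *)

Definition LLP_sub (C : category) (S : mor_class C) : subcategory C.
Proof.
refine (@Subcategory C (fun _ => True) (LLP S) (fun _ _ _ _ => I)
          (fun _ _ _ _ => I) _ _).
- intros x _ a b g _ u v E; exists u; split.
  + apply comp_idr.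
  + now rewrite comp_idr in E.
- intros x y z g f Hg Hf a b k Hk u v E.
  destruct (Hf _ _ _ Hk u (comp v g)) as [h [E1 E2]].
  { now rewrite E, comp_assoc. }
  destruct (Hg _ _ _ Hk h v E2) as [h' [E3 E4]].
  exists h'; split; [|exact E4].
  now rewrite comp_assoc, E3.
Defined.

Definition RLP_sub (C : category) (S : mor_class C) : subcategory C.
Proof.
refine (@Subcategory C (fun _ => True) (RLP S) (fun _ _ _ _ => I)
          (fun _ _ _ _ => I) _ _).
- intros x _ a b f _ u v E; exists v; split.
  + now rewrite comp_idl in E.
  + apply comp_idl.
- intros x y z g f Hg Hf a b k Hk u v E.
  destruct (Hg _ _ _ Hk (comp f u) v) as [h [E1 E2]].
  { now rewrite <- E, comp_assoc. }
  destruct (Hf _ _ _ Hk u h (eq_sym E1)) as [h' [E3 E4]].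
  exists h'; split; [exact E3|].
  now rewrite <- comp_assoc, E4.
Defined.

Lemma lat_lifts (P : blattice) (a b x y : Ob (lat_cat P))
    (f : Hom a b) (g : Hom x y) :
  lifts f g <-> (le (b := P) a x -> le (b := P) b y -> le (b := P) b x).
Proof.
split.
- intros H u v; destruct (H u v (lat_hom_eq _ _)) as [h _]; exact h.
- intros H u v _; exists (H u v); split; apply lat_hom_eq.
Qed.

(* Retract argument: a map with the lifting property is, by antisymmetry, equal to one of its two factors. *)
Lemma lat_wfs (P : blattice) (L R : mor_class (lat_cat P)) :
  (forall a b x y (f : Hom a b) (g : Hom x y),
    L a b f -> R x y g -> lifts f g) ->
  (forall x y (f : Hom x y), exists z (l : Hom x z) (r : Hom z y),
    L x z l /\ R z y r) ->
  is_wfs L R.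
Proof.
intros H F; split.
- intros x y f; split.
  + intros Hf a b g Hg; exact (H _ _ _ _ _ _ Hf Hg).
  + intros Hf; destruct (F x y f) as [z [l [r [Hl Hr]]]].
    pose proof (proj1 (lat_lifts f r) (Hf _ _ _ Hr) l (@le_refl P y)) as yz.
    assert (E := le_antisym yz r); subst z.
    now rewrite (lat_hom_eq f l).
- intros x y f; split.
  + intros Hf a b g Hg; exact (H _ _ _ _ _ _ Hg Hf).
  + intros Hf; destruct (F x y f) as [z [l [r [Hl Hr]]]].
    pose proof (proj1 (lat_lifts l f) (Hf _ _ _ Hl) (@le_refl P x) r) as zx.
    assert (E := le_antisym zx l); subst z.
    now rewrite (lat_hom_eq f r).
- intros x y f; destruct (F x y f) as [z [l [r [Hl Hr]]]].
  exists z, l, r; repeat split; trivial; apply lat_hom_eq.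
Qed.

(** * Model structure from a monotone choice of representatives *)

Section Selector.

Context (P : blattice).
Context (modular : forall x y z : P,
  le x z -> le (meet z (join x y)) (join x (meet z y))).
Context (w : P -> P -> Prop).
Context (wr : forall x, w x x) (ws : forall x y, w x y -> w y x)
  (wt : forall x y z, w x y -> w y z -> w x z).
Context (w_convex : forall x y z, le x y -> le y z -> w x z -> w x y).
Context (w_meet : forall x y, w x y -> w x (meet x y))
  (w_join : forall x y, w x y -> w x (join x y)).
Context (c : P -> P) (c_mono : forall x y, le x y -> le (c x) (c y))
  (c_w : forall x, w x (c x)) (c_inv : forall x y, w x y -> c x = c y).

(** The intended acyclic classes in explicit form: acyclic cofibrations add only parts of the
    representative of the source, acyclic fibrations omit nothing of the target that lies in its
    representative. Cofibrations and fibrations are later defined by lifting against [tfib] and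
    [tcof]. *)
Let tcof : mor_class (lat_cat P) :=
  fun x y _ => w x y /\ le (b := P) y (join x (c x)).
Let tfib : mor_class (lat_cat P) :=
  fun x y _ => w x y /\ le (b := P) (meet y (c y)) x.

(** From [a <= x <= y] and monotonicity of [c], [b] lies below [y] and below [join x (c y)];
    modularity moves the meet inside the join, and [meet y (c y) <= x] finishes. *)
Lemma tcof_lifts_tfib a b x y (f : Hom a b) (g : Hom x y) :
  tcof f -> tfib g -> lifts f g.
Proof.
intros [_ Hf] [_ Hg]; apply lat_lifts; intros ax by_.
assert (ay : le (b := P) a y) by exact (le_trans ax g).
refine (le_trans (meet_glb by_ (y := join x (c y)) _) _).
{ apply (le_trans Hf), join_lub.
  - exact (le_trans ax (join_ubl _ _)).
  - exact (le_trans (c_mono ay) (join_ubr _ _)). }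
apply (le_trans (modular _ g)), join_lub; [apply le_refl|exact Hg].
Qed.

(** The middle object is [join x (c x)] cut down to [y]. The final bound on [z] feeds the retract
    argument in [tfibE]. *)
Lemma tcof_fib_factor x y (f : @Hom (lat_cat P) x y) :
  exists z (l : Hom x z) (r : Hom z y), 
    (tcof l /\ RLP tcof r) /\ le (b := P) (meet y (c x)) z.
Proof.
set (j := join x (c x) : P).
assert (xm : le x (meet j y)) by (apply meet_glb; [apply join_ubl|exact f]).
exists (meet j y), xm, (meet_lbr j y); split; [split|].
- split; [|apply meet_lbl].
  apply (w_convex xm (meet_lbl j y)), w_join, c_w.
- intros a b g [_ Hg]; apply lat_lifts; intros am by_.
  apply meet_glb; [|exact by_].
  assert (aj := le_trans am (meet_lbl _ _)).
  apply (le_trans Hg), join_lub; [exact aj|].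
  apply (le_trans (c_mono aj)).
  (* [x] and [j] are equivalent, so [c j = c x], which lies below [j]. *)
  unfold j; rewrite <- (c_inv (w_join (c_w x))); apply join_ubr.
- apply meet_glb; [|apply meet_lbl].
  exact (le_trans (meet_lbr _ _) (join_ubr _ _)).
Qed.

Lemma cof_tfib_factor x y (f : @Hom (lat_cat P) x y) :
  exists z (l : Hom x z) (r : Hom z y), 
    (LLP tfib l /\ tfib r) /\ le (b := P) z (join x (c y)).
Proof.
set (m := meet y (c y) : P).
assert (my : le (join x m) y) by (apply join_lub; [exact f|apply meet_lbl]).
exists (join x m), (join_ubl x m), my; split; [split|].
- intros a b g [_ Hg]; apply lat_lifts; intros xa mb.
  apply join_lub; [exact xa|].
  assert (mb' := le_trans (join_ubr _ _) mb).
  apply (fun H => le_trans H Hg), meet_glb; [exact mb'|].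
  apply (fun H => le_trans H (c_mono mb')).
  unfold m; rewrite <- (c_inv (w_meet (c_w y))); apply meet_lbr.
- split; [|apply join_ubr].
  (* [join x m] lies between the equivalent elements [m] and [y], so convexity applies. *)
  assert (E := w_meet (c_w y)); fold m in E.
  apply (fun H => wt (ws H) (ws E)).
  exact (w_convex (join_ubr x m) my (ws E)).
- apply join_lub; [apply join_ubl|].
  exact (le_trans (meet_lbr _ _) (join_ubr _ _)).
Qed.

(** For the converse, lifting [f] against its own [tfib] factor gives [y <= z <= join x (c y)], and
    [c y = c x] because [f] is a weak equivalence. *)
Lemma tcofE x y (f : @Hom (lat_cat P) x y) :
  tcof f <-> LLP tfib f /\ w x y.
Proof.
split.
- intros Hf; split; [|apply Hf].
  intros a b g; exact (tcof_lifts_tfib Hf).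
- intros [Hf Hw]; split; [exact Hw|].
  destruct (cof_tfib_factor f) as [z [l [r [[_ Hr] Hz]]]].
  rewrite <- (c_inv Hw) in Hz.
  exact (le_trans (proj1 (lat_lifts f r) (Hf _ _ _ Hr) l (@le_refl P y)) Hz).
Qed.

Lemma tfibE x y (f : @Hom (lat_cat P) x y) :
  tfib f <-> RLP tcof f /\ w x y.
Proof.
split.
- intros Hf; split; [|apply Hf].
  intros a b g Hg; exact (tcof_lifts_tfib Hg Hf).
- intros [Hf Hw]; split; [exact Hw|].
  destruct (tcof_fib_factor f) as [z [l [r [[Hl _] Hz]]]].
  rewrite (c_inv Hw) in Hz.
  exact (le_trans Hz (proj1 (lat_lifts l f) (Hf _ _ _ Hl) (@le_refl P x) r)).
Qed.

(** By [tcofE] and [tfibE] the acyclic parts of the lifting classes are exactly [tcof] and [tfib],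
    so the two factorizations give both systems. Cancellation holds because [w] is an equivalence
    relation. *)
Lemma selector_extends : extends_to_model_structure (wide_sub wr wt).
Proof.
unshelve eexists (@ModelStructure (lat_cat P) (wide_sub wr wt)
  (LLP_sub tfib) (RLP_sub tcof) _ _ _ _); [| | | |reflexivity].
- apply lat_wfs.
  + intros a b x y f g Hf Hg; apply Hf, tfibE, Hg.
  + intros x y f; destruct (cof_tfib_factor f) as [z [l [r [[Hl Hr] _]]]].
    exists z, l, r; split; [exact Hl|]; exact (proj1 (tfibE r) Hr).
- apply lat_wfs.
  + intros a b x y f g Hf Hg; apply Hg, tcofE, Hf.
  + intros x y f; destruct (tcof_fib_factor f) as [z [l [r [[Hl Hr] _]]]].
    exists z, l, r; split; [exact (proj1 (tcofE l) Hl)|exact Hr].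
- intros x y z g f Hg Hgf; exact (wt Hgf (ws Hg)).
- intros x y z g f Hf Hgf; exact (wt (ws Hf) Hgf).
Qed.

End Selector.

(** * Cofibrant and fibrant objects in a lattice model structure *)

(* Factoring [meet a b -> a] as an acyclic cofibration [meet a b -> n] followed by a fibration, which is acyclic by cancellation, cofibrancy of [a] gives [a <= n] and fibrancy of [b] gives [n <= b]. *)
Lemma cofibrant_le_fibrant (P : blattice) (M : model_structure (lat_cat P))
    (a b : P) :
  sub_mor (cof M) (bot_le a : @Hom (lat_cat P) bot a) ->
  sub_mor (fib M) (le_top b : @Hom (lat_cat P) b top) ->
  sub_mor (we M) (meet_lbl a b : @Hom (lat_cat P) (meet a b) a) ->
  le a b.
Proof.
intros Ha Hb Hw.
destruct (wfs_fact (wfs_tcof_fib M) (meet_lbl a b : @Hom (lat_cat P) _ _))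
  as [n [l [r [[Hl Hlw] [Hr E]]]]].
assert (Hrw : sub_mor (we M) r).
{ apply (we_cancel_right Hlw); now rewrite <- E. }
apply (wfs_left (wfs_cof_tfib M)) in Ha.
pose proof (proj1 (lat_lifts _ _) (Ha _ _ _ (conj Hr Hrw))
  (bot_le n) (le_refl a)) as an.
apply (wfs_right (wfs_tcof_fib M)) in Hb.
pose proof (proj1 (lat_lifts _ _) (Hb _ _ _ (conj Hl Hlw))
  (meet_lbr a b) (le_top n)) as nb.
exact (le_trans an nb).
Qed.

Lemma cofibrant_replacement (P : blattice) (M : model_structure (lat_cat P))
    (x : P) :
  exists (a : P) (f : @Hom (lat_cat P) a x),
    sub_mor (cof M) (bot_le a : @Hom (lat_cat P) bot a) /\ sub_mor (we M) f.
Proof.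
destruct (wfs_fact (wfs_cof_tfib M) (bot_le x : @Hom (lat_cat P) bot x))
  as [a [l [r [Hl [[_ Hr] _]]]]].
exists a, r; split; [|exact Hr].
now rewrite (lat_hom_eq _ l).
Qed.

Lemma fibrant_replacement (P : blattice) (M : model_structure (lat_cat P))
    (y : P) :
  exists (b : P) (f : @Hom (lat_cat P) y b),
    sub_mor (fib M) (le_top b : @Hom (lat_cat P) b top) /\ sub_mor (we M) f.
Proof.
destruct (wfs_fact (wfs_tcof_fib M) (le_top y : @Hom (lat_cat P) y top))
  as [b [l [r [[_ Hl] [Hr _]]]]].
exists b, l; split; [|exact Hl].
now rewrite (lat_hom_eq _ r).
Qed.

(** * The lattice of regions and finite difference *)

Definition supported (I J : Type) (F : list I) (G : list J)
    (S : I -> J -> Prop) : Prop :=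
  (forall i i' j, ~ In i F -> ~ In i' F -> S i j -> S i' j) /\
  (forall i j j', ~ In j G -> ~ In j' G -> S i j -> S i j').

(** The support is only asserted to exist, so by proof irrelevance a region is determined by its
    points. *)
Record region (I J : Type) := Region {
  mem :> I -> J -> Prop;
  mem_supported : exists F G, supported F G mem
}.

Definition subregion (I J : Type) (S T : region I J) : Prop :=
  forall i j, S i j -> T i j.

Lemma subregion_antisym (I J : Type) (S T : region I J) :
  subregion S T -> subregion T S -> S = T.
Proof.
destruct S as [S HS], T as [T HT]; unfold subregion; simpl; intros ST TS.
assert (E : S = T).
{ extensionality i; extensionality j; apply propositional_extensionality.
  split; auto. }
subst T; f_equal; apply proof_irrelevance.
Qed.

(** The clauses of [supported] are implications, so any monotone connective preserves them over the
    union of the supports; this serves both meet and join. *)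
Lemma supported_binop (op : Prop -> Prop -> Prop)
    (op_mono : forall p p' q q' : Prop,
      (p -> p') -> (q -> q') -> op p q -> op p' q')
    (I J : Type) (S T : region I J) :
  exists F G, supported F G (fun i j => op (S i j) (T i j)).
Proof.
destruct (mem_supported S) as [F [G [HF HG]]].
destruct (mem_supported T) as [F' [G' [HF' HG']]].
exists (F ++ F'), (G ++ G'); split; intros *; rewrite !in_app_iff;
  intros H1 H2; apply op_mono.
- apply HF; tauto.
- apply HF'; tauto.
- apply HG; tauto.
- apply HG'; tauto.
Qed.

Lemma and_mono (p p' q q' : Prop) :
  (p -> p') -> (q -> q') -> p /\ q -> p' /\ q'.
Proof. tauto. Qed.

Lemma or_mono (p p' q q' : Prop) :
  (p -> p') -> (q -> q') -> p \/ q -> p' \/ q'.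
Proof. tauto. Qed.

Lemma supported_const (I J : Type) (p : Prop) :
  exists F G, @supported I J F G (fun _ _ => p).
Proof. now exists nil, nil. Qed.

Definition regions (I J : Type) : blattice.
Proof.
refine (@Blattice (region I J) (@subregion I J)
  (fun S T => Region (supported_binop and_mono S T))
  (fun S T => Region (supported_binop or_mono S T))
  (Region (supported_const I J False)) (Region (supported_const I J True))
  _ _ (@subregion_antisym I J) _ _ _ _ _ _ _ _);
  unfold subregion; simpl; intros; firstorder.
Defined.

Definition fin_diff (I J : Type) (S T : I -> J -> Prop) : Prop :=
  exists l : list (I * J), forall i j, ~ In (i, j) l -> (S i j <-> T i j).

Section FinDiff.

Context (I J : Type).
Implicit Types S T U : I -> J -> Prop.

Lemma fin_diff_refl S : fin_diff S S.
Proof. now exists nil. Qed.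

Lemma fin_diff_sym S T : fin_diff S T -> fin_diff T S.
Proof. intros [l H]; exists l; intros i j Hl; now rewrite (H i j Hl). Qed.

Lemma fin_diff_trans S T U : fin_diff S T -> fin_diff T U -> fin_diff S U.
Proof.
intros [l H] [l' H']; exists (l ++ l'); intros i j; rewrite in_app_iff.
intros Hl; rewrite H, H' by tauto; reflexivity.
Qed.

(** The rows and columns of the exceptional points are added to the supports; off those rows, or off
    those columns, the two sets agree. *)
Lemma fin_diff_supported S T :
  fin_diff S T -> (exists F G, supported F G S) ->
  exists F G, supported F G T.
Proof.
intros [l H] [F [G [HF HG]]].
assert (out : forall i j, ~ In i (map fst l) \/ ~ In j (map snd l) ->
  S i j <-> T i j).
{ intros i j Hij; apply H; intros Hl.
  destruct Hij as [Hi|Hj]; [apply Hi|apply Hj].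
  - exact (in_map fst _ _ Hl).
  - exact (in_map snd _ _ Hl). }
exists (F ++ map fst l), (G ++ map snd l); split; intros *;
  rewrite !in_app_iff; intros H1 H2; rewrite <- !out by tauto.
- apply HF; tauto.
- apply HG; tauto.
Qed.

End FinDiff.

Definition fin_diff_sub (I J : Type) : subcategory (lat_cat (regions I J)) :=
  @wide_sub (regions I J) (fun S T => fin_diff S T)
    (fun S => fin_diff_refl S)
    (fun S T U => @fin_diff_trans I J S T U).

(** * Back-and-forth along finite partial bijections of columns *)

Definition infinite (J : Type) : Prop :=
  forall l : list J, exists j, ~ In j l.

Section BackAndForth.

Definition partial_bij (J K : Type) (r : list (J * K)) : Prop :=
  forall j k j' k', In (j, k) r -> In (j', k') r -> j = j' <-> k = k'.

(** Every unmatched column on one side is linked to every unmatched column on the other, so over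
    infinite column sets [related] regions are constant across unmatched columns. *)
Definition linked (J K : Type) (r : list (J * K)) (j : J) (k : K) : Prop :=
  In (j, k) r \/ (~ In j (map fst r) /\ ~ In k (map snd r)).

Definition related (I J K : Type) (r : list (J * K))
    (S : region I J) (T : region I K) : Prop :=
  forall j k, linked r j k -> forall i, S i j <-> T i k.

Definition flip (J K : Type) (r : list (J * K)) : list (K * J) :=
  map (fun p => (snd p, fst p)) r.

Lemma in_flip J K (r : list (J * K)) j k : In (k, j) (flip r) <-> In (j, k) r.
Proof.
unfold flip; rewrite in_map_iff; split.
- intros [[j' k'] [E H]]; simpl in E; injection E as <- <-; exact H.
- intros H; now exists (j, k).
Qed.

Lemma in_dom J K (r : list (J * K)) j :
  In j (map fst r) <-> exists k, In (j, k) r.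
Proof.
rewrite in_map_iff; split.
- intros [[j' k] [<- H]]; now exists k.
- intros [k H]; now exists (j, k).
Qed.

Lemma in_ran J K (r : list (J * K)) k :
  In k (map snd r) <-> exists j, In (j, k) r.
Proof.
rewrite in_map_iff; split.
- intros [[j k'] [<- H]]; now exists j.
- intros [j H]; now exists (j, k).
Qed.

Lemma linked_flip J K (r : list (J * K)) j k :
  linked (flip r) k j <-> linked r j k.
Proof.
unfold linked; rewrite !in_dom, !in_ran, in_flip.
split; intros [H|[H1 H2]]; auto; right; split; intros [x Hx].
- apply H2; exists x; now rewrite in_flip.
- apply H1; exists x; now rewrite in_flip.
- apply H2; exists x; now rewrite in_flip in Hx.
- apply H1; exists x; now rewrite in_flip in Hx.
Qed.

Lemma related_flip I J K (r : list (J * K)) (S : region I J) (T : region I K) :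
  related (flip r) T S <-> related r S T.
Proof.
split; intros H j k Hl i; symmetry; apply H; now apply linked_flip.
Qed.

Lemma partial_bij_flip J K (r : list (J * K)) :
  partial_bij r -> partial_bij (flip r).
Proof.
intros H k j k' j' H1 H2; rewrite in_flip in H1, H2.
symmetry; exact (H _ _ _ _ H1 H2).
Qed.

Lemma flip_flip J K (r : list (J * K)) : flip (flip r) = r.
Proof.
unfold flip; rewrite map_map; rewrite <- (map_id r) at 2.
apply map_ext; now intros [].
Qed.

Lemma incl_flip J K (r r' : list (J * K)) :
  incl r r' -> incl (flip r) (flip r').
Proof. intros H [k j]; rewrite !in_flip; apply H. Qed.

(** A pair newly matched by [r'] was unmatched on both sides in [r], so enlarging the bijection
    links fewer columns and [related] persists. *)
Lemma linked_incl J K (r r' : list (J * K)) j k :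
  incl r r' -> partial_bij r' -> linked r' j k -> linked r j k.
Proof.
intros Hi Hb [H|[H1 H2]].
- unfold linked; rewrite in_dom, in_ran.
  destruct (classic (In (j, k) r)) as [|N]; [now left|right].
  split; intros [x Hx]; apply N.
  + now rewrite <- (proj1 (Hb _ _ _ _ (Hi _ Hx) H) eq_refl).
  + now rewrite <- (proj2 (Hb _ _ _ _ (Hi _ Hx) H) eq_refl).
- right; rewrite in_dom, in_ran in *.
  split; intros [x Hx]; [apply H1|apply H2]; exists x; auto.
Qed.

Lemma related_incl I J K (r r' : list (J * K))
    (S : region I J) (T : region I K) :
  incl r r' -> partial_bij r' -> related r S T -> related r' S T.
Proof. intros Hi Hb H j k Hl; exact (H j k (linked_incl Hi Hb Hl)). Qed.

(** The partner is the match of [k] or else a fresh column outside [l]; avoiding [l] keeps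
    differences finite in [related_fin_diff]. *)
Lemma linked_fresh J K (r : list (J * K)) (l : list J) k :
  infinite J -> exists j, linked r j k /\ (In j l -> In (j, k) r).
Proof.
intros HJ; destruct (classic (exists j, In (j, k) r)) as [[j Hj]|N].
- exists j; split; [now left|easy].
- destruct (HJ (map fst r ++ l)) as [j Hj]; rewrite in_app_iff in Hj.
  exists j; split; [right; rewrite in_ran; tauto|tauto].
Qed.

Lemma partial_bij_extend J K (r : list (J * K)) (l : list J) :
  infinite K -> partial_bij r ->
  exists r', incl r r' /\ partial_bij r' /\ incl l (map fst r').
Proof.
intros HK Hr; induction l as [|j l [r' [H1 [H2 H3]]]].
{ exists r; split; [apply incl_refl|split; [exact Hr|easy]]. }
destruct (classic (In j (map fst r'))) as [Hj|Hj].
{ exists r'; split; [exact H1|split; [exact H2|]].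
  now apply incl_cons. }
destruct (HK (map snd r')) as [k Hk].
exists ((j, k) :: r'); split; [now apply incl_tl|split].
- rewrite in_dom in Hj; rewrite in_ran in Hk.
  intros a b a' b' [E|Ha] [E'|Ha'].
  + injection E as <- <-; injection E' as <- <-; tauto.
  + injection E as <- <-; split; intros <-; exfalso; eauto.
  + injection E' as <- <-; split; intros ->; exfalso; eauto.
  + exact (H2 _ _ _ _ Ha Ha').
- simpl; apply incl_cons; [now left|now apply incl_tl].
Qed.

(** Once [r'] covers the column support [G], the region is constant across unmatched columns, so
    each column of [T] can be copied from any linked column of [S]. *)
Lemma forth I J K (r : list (J * K)) (S : region I J) :
  infinite K -> partial_bij r ->
  exists r' (T : region I K), incl r r' /\ partial_bij r' /\ related r' S T.
Proof.
intros HK Hr; destruct (mem_supported S) as [F [G [HF HG]]].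
destruct (partial_bij_extend G HK Hr) as [r' [H1 [H2 H3]]].
assert (HT : exists F G, supported F G
  (fun i k => exists j, linked r' j k /\ S i j)).
{ exists F, (map snd r'); split.
  - intros i i' k Hi Hi' [j [Hl HS]]; exists j; eauto.
  - intros i k k' Hk Hk' [j [[Hl|[Hj _]] HS]].
    + elim Hk; apply in_ran; now exists j.
    + exists j; split; [right; tauto|exact HS]. }
exists r', (Region HT); split; [exact H1|split; [exact H2|]].
intros j k Hl i; simpl; split; [now exists j|].
intros [j' [[Hl'|[Hj' Hk']] HS]].
- destruct Hl as [Hl|[_ Hk]].
  + now rewrite (proj2 (H2 _ _ _ _ Hl Hl') eq_refl).
  + elim Hk; apply in_ran; now exists j'.
- destruct Hl as [Hl|[Hj _]].
  + elim Hk'; apply in_ran; now exists j.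
  (* Both [j] and [j'] are unmatched, hence outside [G]. *)
  + apply (HG i j'); auto.
Qed.

(** This is [forth] for the inverse bijection. *)
Lemma back I J K (r : list (J * K)) (T : region I K) :
  infinite J -> partial_bij r ->
  exists r' (S : region I J), incl r r' /\ partial_bij r' /\ related r' S T.
Proof.
intros HJ Hr.
destruct (forth T HJ (partial_bij_flip Hr)) as [r' [S [H1 [H2 H3]]]].
exists (flip r'), S; split; [|split].
- rewrite <- (flip_flip r); now apply incl_flip.
- now apply partial_bij_flip.
- now apply related_flip.
Qed.

Lemma related_subregion I J K (r : list (J * K)) (S S' : region I J)
    (T T' : region I K) :
  infinite J -> related r S T -> related r S' T' ->
  subregion S S' -> subregion T T'.
Proof.
intros HJ H H' HS i k HT.
destruct (linked_fresh r nil k HJ) as [j [Hl _]].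
apply (H' j k Hl), HS, (H j k Hl), HT.
Qed.

Lemma related_eq I J K (r : list (J * K)) (S S' : region I J)
    (T T' : region I K) :
  infinite J -> related r S T -> related r S' T' -> S = S' -> T = T'.
Proof.
intros HJ H H' E; apply subregion_antisym.
- apply (related_subregion HJ H H'); intros i j; now rewrite E.
- apply (related_subregion HJ H' H); intros i j; now rewrite E.
Qed.

Lemma related_fin_diff I J K (r : list (J * K)) (S S' : region I J)
    (T T' : region I K) :
  infinite J -> related r S T -> related r S' T' ->
  fin_diff S S' -> fin_diff T T'.
Proof.
intros HJ H H' [l Hl].
(* An unmatched [k] is linked to a column free of exceptional points, so differences occur only in
   matched columns and in rows of [l]. *)
exists (list_prod (map fst l) (map snd r)); intros i k Hk.
destruct (linked_fresh r (map snd l) k HJ) as [j [Hjk Hf]].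
rewrite <- (H j k Hjk), <- (H' j k Hjk); apply Hl; intros Hij.
apply Hk, in_prod; [exact (in_map fst _ _ Hij)|].
apply in_ran; exists j; apply Hf; exact (in_map snd _ _ Hij).
Qed.

End BackAndForth.

(** * Elementary equivalence of the region structures *)

(** Arrows of a thin category are determined by their endpoints, so atomic formulas on morphisms
    reduce to equations between objects. *)
Lemma compositeE (P : blattice) (g f h : arrow (lat_cat P)) :
  composite g f h <->
  arr_tgt f = arr_src g /\ arr_src h = arr_src f /\ arr_tgt h = arr_tgt g.
Proof.
split.
- intros H; destruct H; auto.
- destruct g as [x y g], f as [x' y' f], h as [a b h]; simpl.
  intros [<- [-> ->]]; rewrite (lat_hom_eq h (comp g f)); constructor.
Qed.

Lemma arrow_eqE (P : blattice) (f g : arrow (lat_cat P)) :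
  f = g <-> arr_src f = arr_src g /\ arr_tgt f = arr_tgt g.
Proof.
split; [now intros ->|].
destruct f as [x y f], g as [x' y' g]; simpl; intros [<- <-].
now rewrite (lat_hom_eq f g).
Qed.

Section ElementaryEquivalence.

Context (I J K : Type) (HJ : infinite J) (HK : infinite K).

Let C := lat_cat (regions I J).
Let D := lat_cat (regions I K).

Definition arrow_related (r : list (J * K)) (f : arrow C) (g : arrow D) :
    Prop :=
  related (I := I) r (arr_src f) (arr_src g) /\
  related (I := I) r (arr_tgt f) (arr_tgt g).

Section Terms.

Context (r : list (J * K)) (V M : Set).
Context (eo : V -> Ob C) (em : M -> arrow C).
Context (eo' : V -> Ob D) (em' : M -> arrow D).
Context (Ho : forall v, related (I := I) r (eo v) (eo' v)).
Context (Hm : forall m, arrow_related r (em m) (em' m)).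

Lemma eval_ob_related (t : ob_term V M) :
  related (I := I) r (eval_ob eo em t) (eval_ob eo' em' t)
with eval_mor_related (t : mor_term V M) :
  arrow_related r (eval_mor eo em t) (eval_mor eo' em' t).
Proof.
- destruct t as [v|t|t]; simpl.
  + apply Ho.
  + exact (proj1 (eval_mor_related t)).
  + exact (proj2 (eval_mor_related t)).
- destruct t as [m|t]; simpl.
  + apply Hm.
  + split; exact (eval_ob_related t).
Qed.

End Terms.

Lemma related_eqE r (S S' : region I J) (T T' : region I K) :
  related r S T -> related r S' T' -> S = S' <-> T = T'.
Proof.
intros H H'; split; [exact (related_eq HJ H H')|].
apply related_flip in H, H'; exact (related_eq HK H H').
Qed.

Lemma related_fin_diffE r (S S' : region I J) (T T' : region I K) :
  related r S T -> related r S' T' -> fin_diff S S' <-> fin_diff T T'.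
Proof.
intros H H'; split; [exact (related_fin_diff HJ H H')|].
apply related_flip in H, H'; exact (related_fin_diff HK H H').
Qed.

Lemma arrow_forth r (f : arrow C) :
  partial_bij r ->
  exists r' (g : arrow D), incl r r' /\ partial_bij r' /\ arrow_related r' f g.
Proof.
intros Hr; destruct f as [x y f].
destruct (forth x HK Hr) as [r1 [x' [I1 [B1 R1]]]].
destruct (forth y HK B1) as [r2 [y' [I2 [B2 R2]]]].
assert (R1' := related_incl I2 B2 R1).
exists r2, (@Arrow D x' y' (related_subregion HJ R1' R2 f)).
split; [exact (incl_tran I1 I2)|split; [exact B2|]].
split; [exact R1'|exact R2].
Qed.

Lemma arrow_back r (g : arrow D) :
  partial_bij r ->
  exists r' (f : arrow C), incl r r' /\ partial_bij r' /\ arrow_related r' f g.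
Proof.
intros Hr; destruct g as [x' y' g].
destruct (back x' HJ Hr) as [r1 [x [I1 [B1 R1]]]].
destruct (back y' HJ B1) as [r2 [y [I2 [B2 R2]]]].
assert (R1' := related_incl I2 B2 R1).
exists r2, (@Arrow C x y (related_subregion HK
  (proj2 (related_flip r2 x x') R1') (proj2 (related_flip r2 y y') R2) g)).
split; [exact (incl_tran I1 I2)|split; [exact B2|]].
split; [exact R1'|exact R2].
Qed.

Lemma and_iff (p p' q q' : Prop) :
  (p <-> p') -> (q <-> q') -> p /\ q <-> p' /\ q'.
Proof. tauto. Qed.

Lemma sat_related (V M : Set) (p : formula V M) r
    (eo : V -> Ob C) (em : M -> arrow C) (eo' : V -> Ob D) (em' : M -> arrow D) :
  partial_bij r ->
  (forall v, related (I := I) r (eo v) (eo' v)) ->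
  (forall m, arrow_related r (em m) (em' m)) ->
  sat (fin_diff_sub I J) p eo em <-> sat (fin_diff_sub I K) p eo' em'.
Proof.
(* The bijection is generalized because each quantifier enlarges it. *)
revert r eo em eo' em'.
induction p as [V M s t|V M s t|V M g f h|V M t|V M t|V M|V M p IHp q IHq
  |V M p IHp q IHq|V M p IHp q IHq|V M p IH|V M p IH|V M p IH|V M p IH];
  intros r eo em eo' em' Hr Ho Hm; simpl.
- apply (related_eqE (r := r)); now apply eval_ob_related.
- destruct (eval_mor_related Ho Hm s) as [H1 H2].
  destruct (eval_mor_related Ho Hm t) as [H3 H4].
  rewrite !arrow_eqE.
  exact (and_iff (related_eqE H1 H3) (related_eqE H2 H4)).
- destruct (eval_mor_related Ho Hm f) as [H1 H2].
  destruct (eval_mor_related Ho Hm g) as [H3 H4].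
  destruct (eval_mor_related Ho Hm h) as [H5 H6].
  rewrite !compositeE.
  exact (and_iff (related_eqE H2 H3)
    (and_iff (related_eqE H5 H1) (related_eqE H6 H4))).
(* The subcategory is wide, so [sub_ob] is [True] on both sides. *)
- reflexivity.
- destruct (eval_mor_related Ho Hm t) as [H1 H2].
  exact (related_fin_diffE H1 H2).
- reflexivity.
- specialize (IHp r _ _ _ _ Hr Ho Hm); specialize (IHq r _ _ _ _ Hr Ho Hm).
  tauto.
- specialize (IHp r _ _ _ _ Hr Ho Hm); specialize (IHq r _ _ _ _ Hr Ho Hm).
  tauto.
- specialize (IHp r _ _ _ _ Hr Ho Hm); specialize (IHq r _ _ _ _ Hr Ho Hm).
  tauto.
(* Variables already in scope stay related under the larger bijection. *)
- assert (step : forall r' x x', incl r r' -> partial_bij r' ->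
    related (I := I) r' x x' ->
    sat (fin_diff_sub I J) p (ext eo x) em <->
    sat (fin_diff_sub I K) p (ext eo' x') em').
  { intros r' x x' Hi Hb Hx; apply (IH r' _ _ _ _ Hb).
    - intros [v|]; [exact (related_incl Hi Hb (Ho v))|exact Hx].
    - intros m; split; apply (related_incl Hi Hb); apply Hm. }
  split; intros H x.
  + destruct (back x HJ Hr) as [r' [y [Hi [Hb Hx]]]].
    exact (proj1 (step _ _ _ Hi Hb Hx) (H y)).
  + destruct (forth x HK Hr) as [r' [y [Hi [Hb Hx]]]].
    exact (proj2 (step _ _ _ Hi Hb Hx) (H y)).
- assert (step : forall r' x x', incl r r' -> partial_bij r' ->
    related (I := I) r' x x' ->
    sat (fin_diff_sub I J) p (ext eo x) em <->
    sat (fin_diff_sub I K) p (ext eo' x') em').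
  { intros r' x x' Hi Hb Hx; apply (IH r' _ _ _ _ Hb).
    - intros [v|]; [exact (related_incl Hi Hb (Ho v))|exact Hx].
    - intros m; split; apply (related_incl Hi Hb); apply Hm. }
  split; intros [x H].
  + destruct (forth x HK Hr) as [r' [y [Hi [Hb Hx]]]].
    exists y; exact (proj1 (step _ _ _ Hi Hb Hx) H).
  + destruct (back x HJ Hr) as [r' [y [Hi [Hb Hx]]]].
    exists y; exact (proj2 (step _ _ _ Hi Hb Hx) H).
- assert (step : forall r' f g, incl r r' -> partial_bij r' ->
    arrow_related r' f g ->
    sat (fin_diff_sub I J) p eo (ext em f) <->
    sat (fin_diff_sub I K) p eo' (ext em' g)).
  { intros r' f g Hi Hb Hf; apply (IH r' _ _ _ _ Hb).
    - intros v; exact (related_incl Hi Hb (Ho v)).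
    - intros [m|]; [split; apply (related_incl Hi Hb); apply Hm|exact Hf]. }
  split; intros H f.
  + destruct (arrow_back f Hr) as [r' [g [Hi [Hb Hf]]]].
    exact (proj1 (step _ _ _ Hi Hb Hf) (H g)).
  + destruct (arrow_forth f Hr) as [r' [g [Hi [Hb Hf]]]].
    exact (proj2 (step _ _ _ Hi Hb Hf) (H g)).
- assert (step : forall r' f g, incl r r' -> partial_bij r' ->
    arrow_related r' f g ->
    sat (fin_diff_sub I J) p eo (ext em f) <->
    sat (fin_diff_sub I K) p eo' (ext em' g)).
  { intros r' f g Hi Hb Hf; apply (IH r' _ _ _ _ Hb).
    - intros v; exact (related_incl Hi Hb (Ho v)).
    - intros [m|]; [split; apply (related_incl Hi Hb); apply Hm|exact Hf]. }
  split; intros [f H].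
  + destruct (arrow_forth f Hr) as [r' [g [Hi [Hb Hf]]]].
    exists g; exact (proj1 (step _ _ _ Hi Hb Hf) H).
  + destruct (arrow_back f Hr) as [r' [g [Hi [Hb Hf]]]].
    exists g; exact (proj2 (step _ _ _ Hi Hb Hf) H).
Qed.

Lemma satisfies_regions (p : sentence) :
  satisfies (fin_diff_sub I J) p <-> satisfies (fin_diff_sub I K) p.
Proof.
apply sat_related with (r := nil).
- now intros j k j' k' H.
- intros [].
- intros [].
Qed.

End ElementaryEquivalence.

(** * A model structure over countably many columns *)

Definition eventually (A : Type) (Q : A -> Prop) : Prop :=
  exists l, forall a, ~ In a l -> Q a.

Lemma eventually_mono A (Q Q' : A -> Prop) :
  (forall a, Q a -> Q' a) -> eventually Q -> eventually Q'.
Proof. intros H [l Hl]; exists l; auto. Qed.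

(* The upper and lower triangular halves of the grid meet each column, respectively each row, in a finite set, so filling the row [i] right of the diagonal and the column [j] on and below it with constants changes finitely many points in each and keeps distinct rows and columns disjoint. *)
Definition triangular (S : nat -> nat -> Prop) (i j : nat) : Prop :=
  (i < j /\ eventually (fun j' => S i j')) \/
  (j <= i /\ eventually (fun i' => S i' j)).

Lemma triangular_mono (S T : nat -> nat -> Prop) :
  (forall i j, S i j -> T i j) ->
  forall i j, triangular S i j -> triangular T i j.
Proof.
intros H i j [[Hij E]|[Hij E]]; [left|right]; split; trivial;
  revert E; apply eventually_mono; auto.
Qed.

Lemma triangular_fin_diff_le (S T : nat -> nat -> Prop) :
  fin_diff S T -> forall i j, triangular S i j -> triangular T i j.
Proof.
intros [l Hl] i j [[Hij [m Hm]]|[Hij [m Hm]]]; [left|right]; split; trivial.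
- exists (m ++ map snd l); intros j'; rewrite in_app_iff; intros Hj'.
  apply Hl, Hm; [|tauto]; intros H; apply Hj'; right.
  exact (in_map snd _ _ H).
- exists (m ++ map fst l); intros i'; rewrite in_app_iff; intros Hi'.
  apply Hl, Hm; [|tauto]; intros H; apply Hi'; right.
  exact (in_map fst _ _ H).
Qed.

Lemma notin_of_max_lt (l : list nat) n : list_max l < n -> ~ In n l.
Proof.
intros Hn H; pose proof (proj1 (list_max_le l _) (le_n _)) as B.
rewrite Forall_forall in B; specialize (B _ H); lia.
Qed.

Lemma nat_infinite : infinite nat.
Proof.
intros l; exists (Datatypes.S (list_max l)); apply notin_of_max_lt; lia.
Qed.

Lemma eventually_const (Q : nat -> Prop) (l : list nat) n :
  (forall a b, ~ In a l -> ~ In b l -> Q a -> Q b) -> ~ In n l ->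
  eventually Q <-> Q n.
Proof.
intros HQ Hn; split.
- intros [m Hm]; destruct (nat_infinite (l ++ m)) as [a Ha].
  rewrite in_app_iff in Ha; apply (HQ a n); [tauto|exact Hn|apply Hm; tauto].
- intros H; exists l; intros a Ha; exact (HQ n a Hn Ha H).
Qed.

Lemma triangular_fin_diff (S : region nat nat) : fin_diff S (triangular S).
Proof.
destruct (mem_supported S) as [F [G [HF HG]]].
(* [N] exceeds all indices in [F] and [G]. Outside the square of side [N] the larger coordinate is
   off the support, and [triangular] takes its eventual value along exactly that coordinate. *)
set (N := Datatypes.S (max (list_max F) (list_max G))).
exists (list_prod (seq 0 N) (seq 0 N)); intros i j.
rewrite in_prod_iff, !in_seq; intros Hij; unfold triangular.
destruct (Nat.lt_ge_cases i j) as [H|H].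
- assert (Hj : ~ In j G) by (apply notin_of_max_lt; lia).
  pose proof (eventually_const (HG i) Hj) as E; simpl in E.
  split; [tauto|intros [|]; [tauto|lia]].
- assert (Hi : ~ In i F) by (apply notin_of_max_lt; lia).
  pose proof (eventually_const (fun a b => HF a b j) Hi) as E; simpl in E.
  split; [tauto|intros [|]; [lia|tauto]].
Qed.

Lemma countable_extends :
  extends_to_model_structure (fin_diff_sub nat nat).
Proof.
set (c := fun S : region nat nat =>
  Region (fin_diff_supported (triangular_fin_diff S) (mem_supported S))).
apply (@selector_extends (regions nat nat)) with (c := c).
- simpl; unfold subregion; simpl; firstorder.
- intros S T; apply fin_diff_sym.
- intros S T U ST TU [l Hl]; exists l; intros i j Hij.
  specialize (Hl i j Hij); specialize (ST i j); specialize (TU i j); tauto.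
- intros S T [l Hl]; exists l; intros i j Hij; simpl.
  specialize (Hl i j Hij); tauto.
- intros S T [l Hl]; exists l; intros i j Hij; simpl.
  specialize (Hl i j Hij); tauto.
- intros S T ST i j; apply triangular_mono, ST.
- intros S; apply triangular_fin_diff.
- intros S T ST; apply subregion_antisym; intros i j.
  + exact (triangular_fin_diff_le ST (j := j)).
  + exact (triangular_fin_diff_le (fin_diff_sym ST) (j := j)).
Qed.

(** * No model structure over uncountably many columns *)

Lemma cantor_avoid (f : nat -> list (nat -> bool)) :
  exists j, forall i, ~ In j (f i).
Proof.
(* Diagonal sequence: at position [to_nat (i, k)] it differs from entry [k] of [f i]; the default
   pads the finite lists. *)
exists (fun n => negb (nth (snd (of_nat n)) (f (fst (of_nat n)))
                         (fun _ => true) n)).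
intros i H; apply (In_nth _ _ (fun _ => true)) in H.
destruct H as [k [_ E]].
apply (f_equal (fun g => g (to_nat (i, k)))) in E.
rewrite cancel_of_to in E; cbn [fst snd] in E.
now destruct (nth k (f i) (fun _ => true) (to_nat (i, k))).
Qed.

Lemma row_supported I J (i : I) :
  exists F G, supported (J := J) F G (fun i' _ => i' = i).
Proof.
exists (i :: nil), nil; split; simpl.
- intros i1 i2 _ H1 _ E; elim H1; auto.
- trivial.
Qed.

Lemma cocolumn_supported I J (j : J) :
  exists F G, supported (I := I) F G (fun _ j' => j' <> j).
Proof.
exists nil, (j :: nil); split; simpl.
- trivial.
- intros _ j1 j2 _ H2 _ E; apply H2; auto.
Qed.

(** Row [i] leaves the complement of column [j] only at [(i, j)], so the replacements satisfy
    [A i <= B j]. Hence [(i, j)] is missing from [A i], which happens for finitely many [j], or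
    present in [B j], which happens for finitely many [i]. *)
Lemma extends_cover I J :
  extends_to_model_structure (fin_diff_sub I J) ->
  exists (f : I -> list J) (g : J -> list I),
    forall i j, In j (f i) \/ In i (g j).
Proof.
intros [M HM].
assert (HW : forall (S T : region I J) (h : @Hom (lat_cat (regions I J)) S T),
  sub_mor (we M) h <-> fin_diff S T).
{ rewrite HM; reflexivity. }
assert (Hf : forall i, exists (A : region I J) (l : list J),
  sub_mor (cof M) (@bot_le (regions I J) A :
    @Hom (lat_cat (regions I J)) bot A) /\
  fin_diff A (fun i' _ => i' = i) /\ forall j, ~ In j l -> A i j).
{ intros i.
  destruct (@cofibrant_replacement (regions I J) M
    (Region (row_supported J i))) as [A [h [HA Hh]]].
  apply HW in Hh; destruct Hh as [l Hl].
  exists A, (map snd l); split; [exact HA|split; [now exists l|]].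
  intros j Hj; apply Hl; [|reflexivity].
  intros H; exact (Hj (in_map snd _ _ H)). }
assert (Hg : forall j, exists (B : region I J) (l : list I),
  sub_mor (fib M) (@le_top (regions I J) B :
    @Hom (lat_cat (regions I J)) B top) /\
  fin_diff B (fun _ j' => j' <> j) /\ forall i, ~ In i l -> ~ B i j).
{ intros j.
  destruct (@fibrant_replacement (regions I J) M
    (Region (cocolumn_supported I j))) as [B [h [HB Hh]]].
  apply HW in Hh; destruct Hh as [l Hl].
  exists B, (map fst l); split; [exact HB|split].
  - apply fin_diff_sym; now exists l.
  - intros i Hi H; apply (Hl i j); [|exact H|reflexivity].
    intros H'; exact (Hi (in_map fst _ _ H')). }
apply functional_choice in Hf; destruct Hf as [A Hf].
apply functional_choice in Hf; destruct Hf as [f Hf].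
apply functional_choice in Hg; destruct Hg as [B Hg].
apply functional_choice in Hg; destruct Hg as [g Hg].
exists f, g; intros i j.
destruct (Hf i) as [HA [[l Hl] Hfi]], (Hg j) as [HB [[l' Hl'] Hgj]].
apply NNPP; intros N.
apply (Hgj i); [tauto|].
refine (@cofibrant_le_fibrant (regions I J) M (A i) (B j) HA HB _ i j _).
(* Outside the exceptional points of both replacements, only [(i, j)] can separate [A i] from its
   meet with [B j]. *)
- apply HW; exists ((i, j) :: l ++ l'); intros i' j'; simpl.
  rewrite in_app_iff; intros H.
  rewrite (Hl i' j') by tauto; rewrite (Hl' i' j') by tauto.
  split; [tauto|]; intros ->; split; [reflexivity|].
  intros ->; apply H; now left.
- apply Hfi; tauto.
Qed.

Lemma uncountable_not_extends :
  ~ extends_to_model_structure (fin_diff_sub nat (nat -> bool)).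
Proof.
intros H; destruct (extends_cover H) as [f [g Hfg]].
destruct (cantor_avoid f) as [j Hj].
destruct (nat_infinite (g j)) as [i Hi].
destruct (Hfg i j) as [H1|H1]; [exact (Hj i H1)|exact (Hi H1)].
Qed.

Lemma cantor_infinite : infinite (nat -> bool).
Proof.
intros l; destruct (cantor_avoid (fun _ => l)) as [j Hj].
exists j; exact (Hj 0).
Qed.

Theorem theorem1 :
  ~ exists T : sentence -> Prop,
      forall (C : category) (W : subcategory C), finitely_bicomplete C ->
        ((forall p : sentence, T p -> satisfies W p) <->
         extends_to_model_structure W).
Proof.
intros [T HT].
apply uncountable_not_extends, HT; [apply lat_cat_finitely_bicomplete|].
(* The axioms hold over [nat] columns, where a model structure exists, and transfer to [nat -> bool]
   columns. *)
intros p Tp; apply (satisfies_regions nat nat_infinite cantor_infinite p).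
revert p Tp; apply HT; [apply lat_cat_finitely_bicomplete|].
apply countable_extends.
Qed.
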